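(* Suppose $\mathbb{F}_0$ is convex (so that $\langle\mathbb{F}_0\rangle=\mathbb{F}_0$). Then the following three properties hold, both when ''neighborhood of $f^\star$'' is understood with respect to the $L_1(\mu_0)$ topology and when it is understood with respect to the $\mu_0$-weak topology: (a) every neighborhood $U$ of $f^\star$ in $\langle\mathbb{F}_0\rangle$ contains a set of the form $\{f\in\langle\mathbb{F}_0\rangle: K^\star(f_0,f)<\delta\}$ for some $\delta>0$; (b) every neighborhood $U$ of $f^\star$ in $\langle\mathbb{F}_0\rangle$ contains a set of the form $\{f\in\langle\mathbb{F}_0\rangle:\inf_{0\le\alpha\le1}h^\star_\alpha(f_0,f)>e^{-\delta}\}$ for some $\delta>0$; (c) every neighborhood $U$ of $f^\star$ in $\mathbb{F}_0$ contains a set of the form $\{f\in\mathbb{F}_0: h^\star_{\alpha_0}(f_0,f)>e^{-\delta}\}$ for some $0<\alpha_0<1$ and $\delta>0$.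
   Context: Let $(\mathbb{Y},\mathscr{Y},\mu)$ be a $\sigma$-finite measure space, $\mathbb{F}_0$ a family of probability densities with respect to $\mu$, and $f_0$ a probability density with respect to $\mu$, not necessarily in $\mathbb{F}_0$. $\mathsf{E}_0$ denotes expectation under $f_0$. It is understood that families of densities carry a $\sigma$-algebra making $(y,f)\mapsto f(y)$ jointly measurable. $K(f_0,f)=\mathsf{E}_0\log(f_0/f)=\int\log(f_0/f)\,f_0\,d\mu$. There is a fixed unique $f^\star\in\mathbb{F}_0$ with $K(f_0,f^\star)=\inf_{f\in\mathbb{F}_0}K(f_0,f)$, understood to be finite, and $K^\star(f_0,f)=K(f_0,f)-K(f_0,f^\star)$. Standing assumptions: $\int(f/f^\star)f_0\,d\mu<\infty$ for all $f\in\mathbb{F}_0$, and $\int(f_0/f^\star)\,d\mu<\infty$. A set $A$ of densities is called convex if it is closed under mixtures: for every probability measure $\nu$ on $A$, the density $\int_A f\,\nu(df)$ belongs to $A$. $\langle\mathbb{F}_0\rangle$ is the smallest convex set (in this sense) containing $\mathbb{F}_0$. $h^\star_\alpha(f_0,f)=\mathsf{E}_0(f/f^\star)^\alpha=\int(f/f^\star)^\alpha f_0\,d\mu$ for $0<\alpha\le1$, and $h^\star_0(f_0,f)=1$. The measure $\mu_0$ is $d\mu_0=(f_0/f^\star)\,d\mu$. The $L_1(\mu_0)$ topology has basic neighborhoods $\{g:\int|g-f^\star|\,d\mu_0<\epsilon\}$ of $f^\star$. The $\mu_0$-weak topology is the weak topology on $L_1(\mu_0)$ induced by $L_\infty(\mu_0)$: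 basic neighborhoods of $f^\star$ are finite intersections of sets $\{g:|\int\phi\, g\,d\mu_0-\int\phi f^\star\,d\mu_0|<\epsilon\}$ with $\phi\in L_\infty(\mu_0)$, $\epsilon>0$. *)

(* Defs.v *)
(* MathComp-Analysis *)
From HB Require Import structures.
From mathcomp Require Import all_boot all_order all_algebra.
From mathcomp Require Import all_classical all_reals all_analysis.
From mathcomp Require Import measurable_realfun ess_sup_inf.
Set Implicit Arguments.
Unset Strict Implicit.
Unset Printing Implicit Defensive.
Import Order.TTheory GRing.Theory Num.Theory.
Import numFieldNormedType.Exports.
Local Open Scope classical_set_scope.
Local Open Scope ring_scope.
Local Open Scope ereal_scope.

Section densities.
Context d (Y : measurableType d) (R : realType).
Variable mu : {measure set Y -> \bar R}.

(* Densities take values in [0, +oo]: a mixture of finite densities may be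
   infinite on a null set, and is then still defined pointwise. *)
Definition density : set (Y -> \bar R) :=
  [set f : Y -> \bar R | [/\ measurable_fun [set: Y] f, forall y, 0 <= f y
             & \int[mu]_y f y = 1]].

Definition expectation_under (f0 X : Y -> \bar R) : \bar R :=
  \int[mu]_y (X y * f0 y).

(* In \bar R, lne 0 = -oo, lne +oo = +oo, x / 0 = +oo for 0 < x, and
   0 * x = 0 for every x, infinite x included.  The integrand is thus 0 where
   f0 = 0, and +oo where f = 0 < f0. *)
Definition KL (f0 f : Y -> \bar R) : \bar R :=
  expectation_under f0 (fun y => lne (f0 y / f y)).

Definition KLstar (f0 fs f : Y -> \bar R) : \bar R := KL f0 f - KL f0 fs.

Definition hstar (f0 fs : Y -> \bar R) (alpha : R) (f : Y -> \bar R) : \bar R :=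
  if (alpha == 0)%R then 1
  else expectation_under f0 (fun y => (f y / fs y) `^ alpha).

Definition minimizes_KL (f0 : Y -> \bar R) (F0 : set (Y -> \bar R))
    (fs : Y -> \bar R) : Prop :=
  [/\ F0 fs,
      KL f0 fs = ereal_inf [set KL f0 f | f in F0]
    & KL f0 fs \is a fin_num].

End densities.

(* A family F carries the trace of the sigma-algebra generated by S; every
   sigma-algebra on F arises so, from S = [set B | B `&` F belongs to it]. *)
Section mixtures.
Context d (Y : measurableType d) (R : realType).
Variable mu : {measure set Y -> \bar R}.
Variable S : set (set (Y -> \bar R)).

(* Joint measurability of (y, f) |-> f y is required on Y x A only: it may fail
   for every sigma-algebra on the set of all densities. *)
Definition measurable_family (A : set (Y -> \bar R)) : Prop :=
  [/\ A `<=` density mu,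
      measurable (A : set (g_sigma_algebraType S))
    & measurable_fun ([set: Y] `*` (A : set (g_sigma_algebraType S)))
        (fun p : Y * g_sigma_algebraType S => (p.2 : Y -> \bar R) p.1)].

(* If A is itself a measurable family, it is enough to take B = A.  Allowing
   smaller B makes convexity stable under arbitrary intersections. *)
Definition mixture_convex (A : set (Y -> \bar R)) : Prop :=
  A `<=` density mu /\
  forall (B : set (Y -> \bar R)) (nu : probability (g_sigma_algebraType S) R),
    B `<=` A -> measurable_family B -> nu B = 1 ->
    A (fun y => \int[nu]_(f in B) (f : Y -> \bar R) y).

Definition mixture_hull (F : set (Y -> \bar R)) : set (Y -> \bar R) :=
  [set f | forall A, mixture_convex A -> F `<=` A -> A f].

End mixtures.

Lemma measurable_invr (R : realType) :
  measurable_fun [set: R] (fun x : R => x^-1%R).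
Proof.
rewrite -(setvU [set 0%R : R]); apply/measurable_funU => //.
  exact: measurableC.
split; last exact: measurable_fun_set1.
apply: open_continuous_measurable_fun.
  by apply: closed_openC; exact: closed_eq.
by move=> x; rewrite inE /= => /eqP x0; exact: inv_continuous.
Qed.

Lemma measurable_inve (R : realType) :
  measurable_fun [set: \bar R] (fun x : \bar R => x^-1).
Proof.
have -> : (fun x : \bar R => x^-1) =
    (fun x => if x == -oo then -oo else if x == 0 then +oo
              else ((fine x)^-1)%:E).
  by apply/funext => -[r| |] /=; [rewrite {1}/inve eqe|rewrite invr0|].
apply: measurable_fun_ifT => //; first exact: measurable_fun_eqe.
apply: measurable_fun_ifT => //; first exact: measurable_fun_eqe.
apply/measurable_EFinP; apply: measurableT_comp; first exact: measurable_invr.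
exact: fine_measurable.
Qed.

Section ratio_measure.
Context d (Y : measurableType d) (R : realType).
Variables (mu : {measure set Y -> \bar R}) (f0 fs : Y -> \bar R).
Hypotheses (hf0 : density mu f0) (hfs : density mu fs).

(* The proof arguments, unused in the value, carry what the measure instance
   below needs. *)
Definition ratio_measure (hf0 : density mu f0) (hfs : density mu fs)
    (A : set Y) : \bar R :=
  \int[mu]_(y in A) (f0 y / fs y).

Let mratio : measurable_fun [set: Y] (fun y => f0 y / fs y).
Proof.
case: hf0 => mf0 _ _; case: hfs => mfs _ _; apply: emeasurable_funM => //.
by apply: measurableT_comp mfs; exact: measurable_inve.
Qed.

Let ratio_ge0 y : 0 <= f0 y / fs y.
Proof.
case: hf0 => _ f0_ge0 _; case: hfs => _ fs_ge0 _.
by rewrite mule_ge0// inve_ge0.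
Qed.

Let ratio_measure0 : ratio_measure hf0 hfs set0 = 0.
Proof. exact: integral_set0. Qed.

Let ratio_measure_ge0 A : 0 <= ratio_measure hf0 hfs A.
Proof. by apply: integral_ge0 => y _; exact: ratio_ge0. Qed.

Let ratio_measure_sigma_additive :
  semi_sigma_additive (ratio_measure hf0 hfs).
Proof. by apply: semi_sigma_additive_nng_induced => // y; exact: ratio_ge0. Qed.

HB.instance Definition _ := isMeasure.Build _ _ _ (ratio_measure hf0 hfs)
  ratio_measure0 ratio_measure_ge0 ratio_measure_sigma_additive.

End ratio_measure.

Section neighborhoods.
Context d (Y : measurableType d) (R : realType).
Variable mu0 : {measure set Y -> \bar R}.
Implicit Types (fs : Y -> \bar R) (A U : set (Y -> \bar R)).

Definition L1_basic fs : set (set (Y -> \bar R)) :=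
  [set V | exists2 e : R, (0 < e)%R &
     V = [set g : Y -> \bar R | \int[mu0]_y `|g y - fs y| < e%:E]].

Definition weak_basic fs : set (set (Y -> \bar R)) :=
  [set V | exists (n : nat) (phi : 'I_n -> Y -> R) (e : 'I_n -> R),
     [/\ forall i, phi i \in Lfun mu0 +oo,
         forall i, (0 < e i)%R
       & V = [set g : Y -> \bar R | forall i, `|\int[mu0]_y ((phi i y)%:E * g y)
                          - \int[mu0]_y ((phi i y)%:E * fs y)| < (e i)%:E]]].

Definition neighborhood_in (basic : set (set (Y -> \bar R))) A U : Prop :=
  U `<=` A /\ exists2 V, basic V & V `&` A `<=` U.

End neighborhoods.

(* Main.v *)
(** Write [x = f / fs] and let [E0] be the expectation under [f0].  Since [fs]
    minimizes [KL mu f0] on a convex family, the derivative at [t = 0] of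
    [t |-> KL mu f0 (t f + (1 - t) fs)] is nonnegative, which gives
    [E0 x <= 1].  Hence
    [E0 (sqrt x - 1)^2 = E0 x + 1 - 2 h <= 2 (1 - h)], where
    [h = E0 (sqrt x) = hstar mu f0 fs 2^-1 f], and by AM-GM
    [int |f - fs| dmu0 = E0 |x - 1| = E0 (|sqrt x - 1| (sqrt x + 1))] is small
    once [h] is close to [1].  All three properties thus hold with
    [alpha0 = 1/2]: the infimum over [alpha] is at most [h], and
    [KLstar mu f0 fs f >= 2 (1 - h)] because [ln x <= 2 (sqrt x - 1)].  A weak
    neighborhood contains an [L1] ball, as finitely many essentially bounded
    test functions have a common essential bound. *)
From HB Require Import structures.
Require Import Defs.
From mathcomp Require Import all_boot all_order all_algebra.
From mathcomp Require Import all_classical all_reals all_analysis.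
From mathcomp Require Import measurable_realfun ess_sup_inf.
From mathcomp Require Import ring lra.
Set Implicit Arguments.
Unset Strict Implicit.
Unset Printing Implicit Defensive.
Import Order.TTheory GRing.Theory Num.Theory.
Import numFieldNormedType.Exports.
Local Open Scope classical_set_scope.
Local Open Scope ring_scope.
Local Open Scope ereal_scope.

(** * Integrability and linearity for extended-real integrals *)

Section extended_integrals.
Context d (Y : measurableType d) (R : realType).
Implicit Types (mu : {measure set Y -> \bar R}) (f g : Y -> \bar R).

(* The positive and negative parts are compared separately, so neither side
   has to be integrable. *)
Lemma ae_le_integral mu f g :
  measurable_fun setT f -> measurable_fun setT g ->
  {ae mu, forall y, f y <= g y} -> \int[mu]_y f y <= \int[mu]_y g y.
Proof.
move=> mf mg fg; rewrite integralE [leRHS]integralE; apply: leeB.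
  apply: ae_ge0_le_integral => //; [exact: measurable_funepos..|].
  apply: filterS fg => y fg _.
  by rewrite !funeposE ge_max le_max fg/= le_max lexx orbT.
apply: ae_ge0_le_integral => //; [exact: measurable_funeneg..|].
apply: filterS fg => y fg _.
by rewrite !funenegE ge_max le_max leeN2 fg/= le_max lexx orbT.
Qed.

(** The integral is the difference of the integrals of [f^\+] and [f^\-], and a difference in
    [\bar R] is finite only if both terms are. *)
Lemma ae_fin_num_integrable mu f : measurable_fun setT f ->
  \int[mu]_y f y \is a fin_num -> mu.-integrable setT f.
Proof.
move=> mf fin; apply/integrableP; split=> //.
move: fin; rewrite integralE fin_numB => /andP[fp fn].
rewrite (_ : (fun y => _) = f^\+ \+ f^\-); last exact: fune_abse.
rewrite ge0_integralD//; [|exact: measurable_funepos|exact: measurable_funeneg].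
by rewrite lte_add_pinfty// -ge0_fin_numE//; exact: integral_ge0.
Qed.

Lemma integrable_lincomb mu (F G : Y -> R) (a b : R) :
  mu.-integrable setT (EFin \o F) -> mu.-integrable setT (EFin \o G) ->
  mu.-integrable setT (fun y => (a * F y + b * G y)%:E).
Proof.
move=> iF iG; have := integrableD measurableT
  (integrableZl measurableT a iF) (integrableZl measurableT b iG).
exact: eq_integrable.
Qed.

Lemma EFin_Rintegral mu (F : Y -> R) : mu.-integrable setT (EFin \o F) ->
  (\int[mu]_y F y)%R%:E = \int[mu]_y (F y)%:E.
Proof. by move=> iF; rewrite fineK//; exact (integrable_fin_num measurableT iF). Qed.

Lemma integral_lincomb mu (F G : Y -> R) (a b : R) :
  mu.-integrable setT (EFin \o F) -> mu.-integrable setT (EFin \o G) ->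
  \int[mu]_y (a * F y + b * G y)%:E =
  (a * (\int[mu]_y F y) + b * (\int[mu]_y G y))%R%:E.
Proof.
move=> iF iG; rewrite EFinD !EFinM.
rewrite !EFin_Rintegral//.
rewrite -!integralZl// -integralD//; exact: integrableZl.
Qed.

End extended_integrals.

Lemma measurable_lne (R : realType) : measurable_fun [set: \bar R] (@lne R).
Proof.
have -> : @lne R = fun x => if x == +oo then +oo
    else if x <= 0 then -oo else (ln (fine x))%:E.
  by apply/funext => -[r| |]//=; rewrite leNye.
apply: measurable_fun_ifT => //; first exact: measurable_fun_eqe.
apply: measurable_fun_ifT => //; first exact: measurable_fun_lee.
apply/measurable_EFinP; apply: measurableT_comp; first exact: measurable_ln.
exact: fine_measurable.
Qed.

Lemma measurable_sqrt (R : realType) : measurable_fun [set: R] (@Num.sqrt R).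
Proof. by apply: continuous_measurable_fun; exact: sqrt_continuous. Qed.

Section ratio.
Context d (Y : measurableType d) (R : realType).
Variable mu : {measure set Y -> \bar R}.

Lemma measurable_ratio (f g : Y -> \bar R) : density mu f -> density mu g ->
  measurable_fun setT (fun y => f y / g y).
Proof.
move=> [mf _ _] [mg _ _]; apply: emeasurable_funM => //.
by apply: measurableT_comp mg; exact: measurable_inve.
Qed.

Lemma ratio_ge0 (f g : Y -> \bar R) y : density mu f -> density mu g -> 0 <= f y / g y.
Proof. by move=> [_ f_ge0 _] [_ g_ge0 _]; rewrite mule_ge0// inve_ge0. Qed.

End ratio.

(** * Integration against [mu0], and two-point mixtures *)

Section change_of_measure.
Context d (Y : measurableType d) (R : realType).
Variables (mu : {sigma_finite_measure set Y -> \bar R}) (f0 fs : Y -> \bar R).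
Hypotheses (hf0 : density mu f0) (hfs : density mu fs).
Hypothesis mu0_finite : \int[mu]_y (f0 y / fs y) < +oo.

(* The density [f0 / fs] may be infinite, while the library changes variables
   along its own finite Radon-Nikodym derivative; the two agree a.e. *)
Lemma ge0_integral_ratio_measure (g : Y -> \bar R) :
  measurable_fun setT g -> (forall y, 0 <= g y) ->
  \int[ratio_measure hf0 hfs]_y g y = \int[mu]_y (g y * (f0 y / fs y)).
Proof.
move=> mg g0.
have fin : fin_num_fun (ratio_measure hf0 hfs).
  move=> A mA; rewrite ge0_fin_numE//; apply: le_lt_trans mu0_finite.
  apply: ge0_subset_integral => // [|y _].
    exact: measurable_ratio hf0 hfs.
  exact: ratio_ge0 hf0 hfs.
pose fin_mixin := Measure_isFinite.Build _ _ _ (ratio_measure hf0 hfs) fin.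
pose nu : {finite_measure set Y -> \bar R} := 
  HB.pack (ratio_measure hf0 hfs) fin_mixin.
have numu : nu `<< mu.
  apply/null_content_dominatesP => A mA A0.
  apply: null_set_integral => //; apply: measurable_funTS.
  exact: measurable_ratio hf0 hfs.
have mrat := measurable_ratio hf0 hfs.
have ae_rn : ae_eq mu setT (Radon_Nikodym_SigmaFinite.f nu mu)
    (fun y => f0 y / fs y).
  apply: integral_ae_eq => //.
    exact: Radon_Nikodym_SigmaFinite.f_integrable.
  by move=> A _ mA; rewrite -Radon_Nikodym_SigmaFinite.f_integral.
rewrite -[LHS](Radon_Nikodym_SigmaFinite.change_of_variables numu)//.
apply: ae_eq_integral => //.
- apply: emeasurable_funM => //.
  exact: measurable_int (Radon_Nikodym_SigmaFinite.f_integrable numu).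
- exact: emeasurable_funM.
- exact: ae_eqe_mul2l.
Qed.

End change_of_measure.

(** A two-point mixture is the mixture along the image of a Bernoulli law under [true |-> f],
    [false |-> g]. This law lives on [F], so convexity applies with [B = F], and integrating against
    it gives the weighted sum. *)
Lemma mixture_convex2 d (Y : measurableType d) (R : realType)
    (mu : {measure set Y -> \bar R}) (S : set (set (Y -> \bar R)))
    (F : set (Y -> \bar R)) (f g : Y -> \bar R) (t : R) :
  measurable_family mu S F -> mixture_convex mu S F -> F f -> F g ->
  (0 <= t <= 1)%R -> F (fun y => t%:E * f y + (1 - t)%:E * g y).
Proof.
move=> [FD mF mev] [_ convF] Ff Fg t01.
pose h (b : bool) : g_sigma_algebraType S := if b then f else g.
have mh : measurable_fun setT h by [].
pose h_mixin := isMeasurableFun.Build _ _ _ _ h mh.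
pose X : {mfun bool >-> g_sigma_algebraType S} := HB.pack h h_mixin.
pose nu : probability (g_sigma_algebraType S) R :=
  distribution (bernoulli_prob t) X.
have FX : X @^-1` (F : set (g_sigma_algebraType S)) = setT.
  by apply/seteqP; split=> // -[].
have F1 : nu F = 1 by rewrite -(probability_setT (bernoulli_prob t)) -FX.
have := convF F nu (@subset_refl _ F) (And3 FD mF mev) F1.
congr F; apply/funext => y.
have F_ge0 (k : g_sigma_algebraType S) : F k -> 0 <= (k : Y -> \bar R) y.
  by move=> /FD[_ k0 _].
have mevy : measurable_fun (F : set (g_sigma_algebraType S))
    (fun k : g_sigma_algebraType S => (k : Y -> \bar R) y).
  apply: (measurable_comp _ _ mev (g := pair y)).
  - exact: measurableX.
  - by move=> _ [k Fk <-].
  - exact: measurable_funTS.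
rewrite ge0_integral_pushforward//; last by move=> k; rewrite inE; exact: F_ge0.
rewrite FX integral_bernoulli_prob//.
by case; rewrite /= F_ge0.
Qed.

(** * Pointwise inequalities for likelihood ratios *)

Section pointwise.
Context (R : realType).
Implicit Types a b c t : R.
Local Open Scope ring_scope.

Lemma ln_le_subr1 (z : R) : 0 < z -> ln z <= z - 1.
Proof.
by move=> z0; rewrite -{1}(subrK 1 z) addrC le_ln1Dx//; lra.
Qed.

(* With [s = sqrt x], this expands [0 <= (k |s - 1| - (s + 1))^2]. *)
Lemma normB1_le (k x : R) : 0 < k -> 0 <= x ->
  `|x - 1| <= (k / 2 + (2 * k)^-1) * (x + 1)
              - (k - k^-1) * Num.sqrt x.
Proof.
move=> k0 x0; set s := Num.sqrt x.
have s0 : 0 <= s by exact: sqrtr_ge0.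
have -> : x = s ^+ 2 by rewrite sqr_sqrtr.
have sk : 0 <= (k * `|s - 1| - (s + 1)) ^+ 2 / (2 * k).
  by rewrite divr_ge0 ?sqr_ge0// ltW// mulr_gt0.
have sq : `|s - 1| ^+ 2 = (s - 1) ^+ 2 by rewrite real_normK// num_real.
have -> : s ^+ 2 - 1 = (s - 1) * (s + 1) by ring.
rewrite normrM (ger0_norm (_ : 0 <= s + 1)); last by lra.
rewrite -subr_ge0 (le_trans sk)// le_eqVlt; apply/orP; left; apply/eqP.
rewrite (_ : (k * `|s - 1| - (s + 1)) ^+ 2 = k ^+ 2 * `|s - 1| ^+ 2
  - 2 * k * `|s - 1| * (s + 1) + (s + 1) ^+ 2); last by ring.
rewrite sq; field.
by rewrite gt_eqF.
Qed.

Variables (a b : R).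
Hypotheses (a0 : 0 <= a) (b0 : 0 <= b) (ab : 0 < a -> 0 < b).

Local Open Scope ereal_scope.

(** Here [a], [b], [c] stand for the values of [f0], [fs], [f] at a point. If [a = 0], both sides
    vanish by the convention [0 * x = 0], even when [b = 0]; otherwise [b > 0] and the extended
    division is the real one. The identities below follow the same split. *)
Lemma ratioM c : (c%:E / b%:E) * a%:E = (c / b * a)%:E.
Proof.
have [->|aN0] := eqVneq a 0%R; first by rewrite mule0 mulr0.
by rewrite inver gt_eqF ?ab ?lt0r ?aN0.
Qed.

Lemma powRratioM c (r : R) :
  (c%:E / b%:E) `^ r * a%:E = ((c / b) `^ r * a)%:E.
Proof.
have [->|aN0] := eqVneq a 0%R; first by rewrite mule0 mulr0.
by rewrite inver gt_eqF ?ab ?lt0r ?aN0.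
Qed.

Lemma normB_ratioM c :
  `|c%:E - b%:E| * (a%:E / b%:E) = (`|c / b - 1| * a)%:E.
Proof.
have [->|aN0] := eqVneq a 0%R; first by rewrite mul0e mule0 mulr0.
have b_gt0 : (0 < b)%R by rewrite ab// lt0r aN0.
rewrite inver gt_eqF// -!EFinM; congr EFin.
rewrite (_ : c / b - 1 = (c - b) / b)%R; last first.
  by rewrite mulrBl divff ?gt_eqF.
by rewrite normrM (gtr0_norm (_ : 0 < b^-1)%R) ?invr_gt0//; ring.
Qed.

Lemma lne_ratioM : lne (a%:E / b%:E) * a%:E = (ln (a / b) * a)%:E.
Proof.
have [->|aN0] := eqVneq a 0%R; first by rewrite mule0 mulr0.
have a_gt0 : (0 < a)%R by rewrite lt0r aN0.
by rewrite inver gt_eqF ?ab// -EFinM lne_EFin// divr_gt0 ?ab.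
Qed.

(* [ln x = 2 ln (sqrt x) <= 2 (sqrt x - 1)] with [x = c / b]. *)
Lemma lne_ratioM_ge c : (0 <= c)%R ->
  (ln (a / b) * a - 2 * (Num.sqrt (c / b) - 1) * a)%:E <=
  lne (a%:E / c%:E) * a%:E.
Proof.
move=> c0; have [->|aN0] := eqVneq a 0%R.
  by rewrite mule0 !mulr0 subr0.
have a_gt0 : (0 < a)%R by rewrite lt0r aN0.
have b_gt0 := ab a_gt0.
move: c0; rewrite le_eqVlt => /predU1P[<-|c_gt0].
  (* If [c = 0 < a], the right-hand side is [+oo]. *)
  by rewrite inver eqxx gt0_muley ?lte_fin//= gt0_mulye ?lte_fin// leey.
rewrite inver gt_eqF// -EFinM lne_EFin ?divr_gt0// -EFinM lee_fin.
rewrite -mulrBl ler_wpM2r// lerBlDr -lerBlDl.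
rewrite -ln_div ?posrE ?divr_gt0//.
rewrite (_ : a / b / (a / c) = Num.sqrt (c / b) ^+ 2)%R; last first.
  rewrite sqr_sqrtr ?divr_ge0 ?ltW//; field.
  by rewrite !gt_eqF.
have s_gt0 : (0 < Num.sqrt (c / b))%R by rewrite sqrtr_gt0 divr_gt0.
by rewrite lnXn// -(mulr_natl (ln _)) ler_wpM2l// ln_le_subr1.
Qed.

(* [ln (1 + u) >= u / (1 + u)] with [u = t (c / b - 1)]. *)
Lemma lne_mixtureM_le c t : (0 <= c)%R -> (0 <= t < 1)%R ->
  lne (a%:E / (t%:E * c%:E + (1 - t)%:E * b%:E)) * a%:E <=
  (ln (a / b) * a - t * ((c / b - 1) / (1 + t * (c / b - 1)) * a))%:E.
Proof.
move=> c0 /andP[t0 t1]; have [->|aN0] := eqVneq a 0%R.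
  by rewrite mule0 !mulr0 subr0.
have a_gt0 : (0 < a)%R by rewrite lt0r aN0.
have b_gt0 := ab a_gt0.
rewrite -!EFinM -EFinD; set z := (_ + _)%R.
have z_gt0 : (0 < z)%R.
  by rewrite ltr_wpDl ?mulr_ge0// mulr_gt0// subr_gt0.
rewrite inver gt_eqF// -EFinM lne_EFin ?divr_gt0// -EFinM lee_fin.
rewrite mulrA -mulrBl ler_wpM2r// -lerBlDl -ln_div ?posrE ?divr_gt0//.
apply: le_trans (ln_le_subr1 _) _; first by rewrite !divr_gt0.
rewrite le_eqVlt; apply/orP; left; apply/eqP.
rewrite /z; field.
have zE : (b + t * (c + -1 * b) = z)%R by rewrite /z; ring.
by rewrite zE !gt_eqF.
Qed.

End pointwise.

Lemma measurable_fine_density d (Y : measurableType d) (R : realType)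
    (mu : {measure set Y -> \bar R}) (f : Y -> \bar R) :
  density mu f -> measurable_fun setT (fine \o f).
Proof. by move=> [mf _ _]; exact: measurableT_comp. Qed.

Lemma integrable_density d (Y : measurableType d) (R : realType)
    (mu : {measure set Y -> \bar R}) (f : Y -> \bar R) :
  density mu f -> mu.-integrable setT f.
Proof.
move=> [mf f_ge0 f1]; apply/integrableP; split=> //.
by under eq_integral do rewrite gee0_abs//; rewrite f1 ltry.
Qed.

(** * Passage from extended-real densities to real integrands *)

Section real_valued_representatives.
Context d (Y : measurableType d) (R : realType).
Variables (mu : {measure set Y -> \bar R}) (f0 fs : Y -> \bar R).
Hypotheses (hf0 : density mu f0) (hfs : density mu fs).
Hypothesis KL_fin : KL mu f0 fs \is a fin_num.
Implicit Types f : Y -> \bar R.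

Local Notation p := (fun y => fine (f0 y)).
Local Notation x f := (fun y => (fine (f y) / fine (fs y))%R).
Local Notation L := (fun y => (ln (fine (f0 y) / fine (fs y)) * fine (f0 y))%R).

Lemma ratio_real_ge0 f y : density mu f -> (0 <= x f y)%R.
Proof.
by move: hfs => [_ fs0 _] [_ g0 _]; rewrite divr_ge0// fine_ge0.
Qed.

Lemma measurable_ratio_real f : density mu f -> measurable_fun setT (x f).
Proof.
move=> hf; apply: measurable_funM; first exact: measurable_fine_density hf.
apply: measurableT_comp; first exact: measurable_invr.
exact: measurable_fine_density hfs.
Qed.

Lemma measurable_density_log f : density mu f ->
  measurable_fun setT (fun y => lne (f0 y / f y) * f0 y).
Proof.
move=> hf; apply: emeasurable_funM; last by case: hf0.
by apply: measurableT_comp (measurable_ratio hf0 hf); exact: measurable_lne.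
Qed.

Lemma integrable_density_log :
  mu.-integrable setT (fun y => lne (f0 y / fs y) * f0 y).
Proof. by apply: ae_fin_num_integrable => //; exact: measurable_density_log. Qed.

(** Integrable functions are finite a.e., which applies to the three densities and, since
    [KL mu f0 fs] is finite, to its integrand. The latter is [+oo] where [fs = 0 < f0], so a.e.
    [f0 > 0] forces [fs > 0]. *)
Lemma ae_real_valued f : density mu f ->
  {ae mu, forall y, exists a b c : R,
    [/\ f0 y = a%:E, fs y = b%:E & f y = c%:E] /\
    [/\ (0 <= a)%R, (0 <= b)%R, (0 <= c)%R & (0 < a)%R -> (0 < b)%R]}.
Proof.
move=> hf.
have fin g (ig : mu.-integrable setT g) := integrable_ae measurableT ig.
apply: filterS2 (filterI (fin _ (integrable_density hf0))
    (fin _ (integrable_density hfs)))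
  (filterI (fin _ (integrable_density hf)) (fin _ integrable_density_log)).
move=> y [/(_ I) + /(_ I) +] [/(_ I) + /(_ I)].
move: hf0 hfs hf => [_ /(_ y) + _] [_ /(_ y) + _] [_ /(_ y) + _].
case: (f0 y) => // a; case: (fs y) => // b; case: (f y) => // c.
rewrite !lee_fin => a0 b0 c0 _ _ _ h; exists a, b, c; split=> //; split=> //.
move=> a_gt0; rewrite lt0r b0 andbT; apply: contraTneq h => ->.
by rewrite inver eqxx gt0_muley ?lte_fin//= gt0_mulye ?lte_fin.
Qed.

Lemma expectation_ratioE f : density mu f ->
  expectation_under mu f0 (fun y => f y / fs y) =
  \int[mu]_y (x f y * p y)%:E.
Proof.
move=> hf; apply: ae_eq_integral => //.
- by apply: emeasurable_funM; [exact: measurable_ratio hf hfs|case: hf0].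
- apply/measurable_EFinP; apply: measurable_funM.
    exact: measurable_ratio_real.
  exact: measurable_fine_density hf0.
- apply: filterS (ae_real_valued hf) => y [a [b [c [[-> -> ->]]]]] /=.
  by move=> [a0 b0 _ ab] _; rewrite ratioM.
Qed.

Lemma expectation_sqrt_ratioE f : density mu f ->
  expectation_under mu f0 (fun y => (f y / fs y) `^ 2^-1) =
  \int[mu]_y (Num.sqrt (x f y) * p y)%:E.
Proof.
move=> hf.
transitivity (\int[mu]_y (x f y `^ 2^-1 * p y)%:E); last first.
  by apply: eq_integral => y _; rewrite powR12_sqrt// ratio_real_ge0.
apply: ae_eq_integral => //.
- apply: emeasurable_funM; last by case: hf0.
  apply: (measurableT_comp (measurable_poweR _)).
  exact: measurable_ratio hf hfs.
- apply/measurable_EFinP; apply: measurable_funM.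
    apply: (measurableT_comp (measurable_powR _)).
    exact: measurable_ratio_real.
  exact: measurable_fine_density hf0.
- apply: filterS (ae_real_valued hf) => y [a [b [c [[-> -> ->]]]]] /=.
  by move=> [a0 b0 _ ab] _; rewrite powRratioM.
Qed.

Lemma measurable_normB_ratio_real f : density mu f ->
  measurable_fun setT (fun y => (`|x f y - 1| * p y)%:E).
Proof.
move=> hf; apply/measurable_EFinP; apply: measurable_funM; last first.
  exact: measurable_fine_density hf0.
apply: measurableT_comp => //; apply: measurable_funB => //.
exact: measurable_ratio_real.
Qed.

(** By the change of measure, the left-hand side is the [L1(mu0)] distance from [f] to [fs]. *)
Lemma normB_ratioE f : density mu f ->
  \int[mu]_y (`|f y - fs y| * (f0 y / fs y)) =
  \int[mu]_y (`|x f y - 1| * p y)%:E.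
Proof.
move=> hf; have [mf _ _] := hf; have [mfs _ _] := hfs.
apply: ae_eq_integral => //.
- apply: emeasurable_funM; last exact: measurable_ratio hf0 hfs.
  by apply: measurableT_comp => //; exact: emeasurable_funB.
- exact: measurable_normB_ratio_real.
- apply: filterS (ae_real_valued hf) => y [a [b [c [[-> -> ->]]]]] /=.
  by move=> [a0 b0 _ ab] _; rewrite normB_ratioM.
Qed.

Lemma measurable_log_real : measurable_fun setT L.
Proof.
apply: measurable_funM; last exact: measurable_fine_density hf0.
apply: measurableT_comp; first exact: measurable_ln.
exact: measurable_ratio_real.
Qed.

Lemma ae_log_real : ae_eq mu setT (fun y => lne (f0 y / fs y) * f0 y) (EFin \o L).
Proof.
apply: filterS (ae_real_valued hfs) => y /= [a [b [c [[-> -> _]]]]].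
by move=> [a0 b0 _ ab] _; exact: lne_ratioM.
Qed.

Lemma KL_realE : KL mu f0 fs = \int[mu]_y (L y)%:E.
Proof.
apply: (ae_eq_integral (EFin \o L)) ae_log_real => //.
  exact: measurable_density_log.
exact/measurable_EFinP/measurable_log_real.
Qed.

Lemma integrable_log_real : mu.-integrable setT (EFin \o L).
Proof.
apply: ae_fin_num_integrable; last by rewrite -KL_realE.
exact/measurable_EFinP/measurable_log_real.
Qed.

(** Integrated form of [lne_ratioM_ge]. The value [KL mu f0 f] may be [+oo], hence a comparison of
    integrals that does not presuppose integrability on the right. *)
Lemma KL_ge f : density mu f ->
  \int[mu]_y (L y - 2 * (Num.sqrt (x f y) - 1) * p y)%:E <= KL mu f0 f.
Proof.
move=> hf; apply: ae_le_integral.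
- apply/measurable_EFinP; apply: measurable_funB; first exact: measurable_log_real.
  apply: measurable_funM; last exact: measurable_fine_density hf0.
  apply: measurable_funM => //; apply: measurable_funB => //.
  apply: measurableT_comp; last exact: measurable_ratio_real.
  exact: measurable_sqrt.
- exact: measurable_density_log.
- apply: filterS (ae_real_valued hf) => y [a [b [c [[-> -> ->]]]]] /=.
  by move=> [a0 b0 c0 ab]; exact: lne_ratioM_ge.
Qed.

(* Under [f0], a minorant of the difference quotient [ln (1 + t (x - 1)) / t],
   which tends to [x - 1] as [t] goes to 0. *)
Local Notation w t f :=
  (fun y => ((x f y - 1) / (1 + t * (x f y - 1)) * p y)%R).

Lemma measurable_mixture_slope f t : density mu f -> measurable_fun setT (w t f).
Proof.
move=> hf; have mx := measurable_ratio_real hf.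
apply: measurable_funM; last exact: measurable_fine_density hf0.
apply: measurable_funM; first exact: measurable_funB.
apply: measurableT_comp; first exact: measurable_invr.
by apply: measurable_funD => //; apply: measurable_funM => //; exact: measurable_funB.
Qed.

(** Integrated form of [lne_mixtureM_le]; since [t < 1], the mixture is positive a.e. where [f0]
    is. *)
Lemma KL_mixture_le f t : density mu f -> (0 <= t < 1)%R ->
  density mu (fun y => t%:E * f y + (1 - t)%:E * fs y) ->
  KL mu f0 (fun y => t%:E * f y + (1 - t)%:E * fs y) <=
  \int[mu]_y (L y - t * w t f y)%:E.
Proof.
move=> hf t01 hft; apply: ae_le_integral.
- exact: measurable_density_log.
- apply/measurable_EFinP; apply: measurable_funB; first exact: measurable_log_real.
  by apply: measurable_funM => //; exact: measurable_mixture_slope.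
- apply: filterS (ae_real_valued hf) => y [a [b [c [[-> -> ->]]]]] /=.
  by move=> [a0 b0 c0 ab]; exact: lne_mixtureM_le.
Qed.

Lemma ae_density_real : ae_eq mu setT f0 (EFin \o p).
Proof.
have := integrable_ae measurableT (integrable_density hf0).
by apply: filterS => y /(_ I) fin _; rewrite /= fineK.
Qed.

Lemma integral_density_real : \int[mu]_y (p y)%:E = 1.
Proof.
have [mf0 _ <-] := hf0; apply/esym/ae_eq_integral => //; last exact: ae_density_real.
exact/measurable_EFinP/(measurable_fine_density hf0).
Qed.

Lemma density_real_ge0 y : (0 <= p y)%R.
Proof. by have [_ f0_ge0 _] := hf0; rewrite fine_ge0. Qed.

Lemma integrable_density_real : mu.-integrable setT (EFin \o p).
Proof.
apply: ae_fin_num_integrable; last by rewrite integral_density_real.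
exact/measurable_EFinP/(measurable_fine_density hf0).
Qed.

(** * First variation of [KL] at [fs], and the resulting bounds on [sqrt (f / fs)] and on the [L1]
    distance *)

Section finite_expectation.
Variable f : Y -> \bar R.
Hypothesis hf : density mu f.
Hypothesis ratio_lty : expectation_under mu f0 (fun y => f y / fs y) < +oo.

Lemma integrable_ratio_real : mu.-integrable setT (EFin \o (x f \* p)%R).
Proof.
apply: ae_fin_num_integrable.
  apply/measurable_EFinP; apply: measurable_funM.
    exact: measurable_ratio_real.
  exact: measurable_fine_density hf0.
rewrite -expectation_ratioE// ge0_fin_numE//; apply: integral_ge0 => y _.
by have [_ f0_ge0 _] := hf0; rewrite mule_ge0// (ratio_ge0 _ hf hfs).
Qed.

(** Since [x >= 0] and [t <= 1/2], the denominator [1 + t (x - 1)] is at least [1 - t >= 1/2], while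
    [|x - 1| <= x + 1]. The bound is uniform in [t], as dominated convergence requires. *)
Lemma mixture_slope_le t y : (0 < t <= 2^-1)%R ->
  (`|w t f y| <= 2 * (x f y * p y + p y))%R.
Proof.
move=> /andP[t0 t1]; have x0 := ratio_real_ge0 y hf.
have p0 := density_real_ge0 y; rewrite normrM (ger0_norm p0).
rewrite (_ : 2 * _ = 2 * (x f y + 1) * p y)%R; last by ring.
rewrite ler_wpM2r//; set z := (_ / _)%R in x0 *.
have den : (2^-1 <= 1 + t * (z - 1))%R by nra.
have den_gt0 : (0 < 1 + t * (z - 1))%R by lra.
rewrite normrM normfV (gtr0_norm den_gt0) ler_pdivrMr//.
have : (`|z - 1| <= z + 1)%R by rewrite ler_norml; apply/andP; split; lra.
by move/le_trans; apply; nra.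
Qed.

Lemma integrable_mixture_slope t : (0 < t <= 2^-1)%R ->
  mu.-integrable setT (EFin \o w t f).
Proof.
move=> t01.
have ixp := integrable_ratio_real; have ip := integrable_density_real.
apply: le_integrable (integrableZl measurableT 2 (integrableD measurableT ixp ip)).
- by [].
- exact/measurable_EFinP/measurable_mixture_slope.
- move=> y _; rewrite /= lee_fin.
  by apply: le_trans (ler_norm _); exact: mixture_slope_le.
Qed.

(** Minimality and [KL_mixture_le] give [KL fs <= KL fs - t * int w]; the finite term [KL fs]
    cancels and [t > 0] divides out. *)
Lemma integral_mixture_slope_le0 t : (0 < t <= 2^-1)%R ->
  density mu (fun y => t%:E * f y + (1 - t)%:E * fs y) ->
  KL mu f0 fs <= KL mu f0 (fun y => t%:E * f y + (1 - t)%:E * fs y) ->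
  \int[mu]_y (w t f y)%:E <= 0.
Proof.
move=> t01 hft /le_trans/(_ (KL_mixture_le hf _ hft)).
have [/andP[t0 t1] iw] := (t01, integrable_mixture_slope t01).
have iL := integrable_log_real.
have := integrable_fin_num measurableT iL.
have := integrable_fin_num measurableT iw.
rewrite KL_realE integralB_EFin//; last first.
  by apply: eq_integrable (integrableZl measurableT t iw).
under [X in _ -> _ -> (_ -> _ <= _ - X) -> _]eq_integral do rewrite EFinM.
rewrite integralZl// /comp => /fineK <- /fineK <-.
rewrite -EFinM -EFinB !lee_fin => /(_ _)/wrap[]; first lra.
by rewrite lerBrDr -lerBrDl subrr pmulr_rle0.
Qed.

(** As [t] tends to 0, the slopes [w t f] tend to [(x - 1) p] under a common integrable bound. Their
    integrals are nonpositive, so the limit [E0 x - 1] is too. *)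
Lemma integral_ratio_le1 :
  (forall t : R, (0 < t <= 2^-1)%R ->
    let ft := fun y => t%:E * f y + (1 - t)%:E * fs y in
    density mu ft /\ KL mu f0 fs <= KL mu f0 ft) ->
  \int[mu]_y (x f y * p y)%:E <= 1.
Proof.
move=> mix.
(* [harmonic n.+1] is [1 / (n + 2)]; the shift keeps every [t n] at most [1/2]. *)
pose t n : R := harmonic n.+1.
have t01 n : (0 < t n <= 2^-1)%R.
  by rewrite /t /= invr_gt0 ltr0n/= lef_pV2 ?posrE// ler_nat.
have slope_le0 n : \int[mu]_y (w (t n) f y)%:E <= 0.
  by have [ft KLft] := mix _ (t01 n); exact: integral_mixture_slope_le0.
have ixp := integrable_ratio_real; have ip := integrable_density_real.
have [] := @dominated_convergence _ _ _ mu setT measurableT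
  (fun n => EFin \o w (t n) f) (fun y => (x f y * p y - p y)%:E)
  (fun y => (2 * (x f y * p y + p y))%:E).
- by move=> n; exact/measurable_EFinP/measurable_mixture_slope.
- exact: measurable_int (integrableB measurableT ixp ip).
- apply: aeW => y _; apply: cvg_EFin; first exact: nearW.
  (* The limit is written as the slope at [t = 0], so that the limit rules apply factor by
     factor. *)
  rewrite (_ : _ - _ = (x f y - 1) / (1 + 0 * (x f y - 1)) * p y)%R; last first.
    by rewrite mul0r addr0 divr1 mulrBl mul1r.
  apply: cvgMr_tmp; apply: cvgMl_tmp; apply: cvgV; first by rewrite mul0r addr0.
  apply: cvgD; first exact: cvg_cst.
  by apply: cvgMr_tmp; have := @cvg_harmonic R; rewrite -cvg_shiftS.
- apply: eq_integrable (integrableZl measurableT 2 (integrableD measurableT ixp ip)) => //.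
- apply: aeW => y n _; rewrite lee_fin.
  exact: mixture_slope_le.
move=> _ _ cvg_slope.
have : \int[mu]_y (x f y * p y - p y)%:E <= 0.
  rewrite -(cvg_lim _ cvg_slope)//; apply: lime_le; first exact/cvgP/cvg_slope.
  exact: nearW.
by rewrite integralB_EFin// integral_density_real sube_le0.
Qed.

(** AM-GM for [x] and 1, from [(s - 1)^2 >= 0] with [s = sqrt x]. It yields both the integrability
    of [sqrt x] under [f0] and [h <= 1]. *)
Lemma sqrt_ratio_le y :
  (Num.sqrt (x f y) * p y <= 2^-1 * (x f y * p y + p y))%R.
Proof.
rewrite (_ : 2^-1 * _ = 2^-1 * (x f y + 1) * p y)%R; last by ring.
rewrite ler_wpM2r ?density_real_ge0//.
rewrite -{2}(sqr_sqrtr (ratio_real_ge0 y hf)); set s := Num.sqrt _.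
by have := sqr_ge0 (s - 1); nra.
Qed.

Lemma integrable_sqrt_ratio :
  mu.-integrable setT (EFin \o (fun y => Num.sqrt (x f y) * p y)%R).
Proof.
have ixp := integrable_ratio_real; have ip := integrable_density_real.
apply: le_integrable
  (integrableZl measurableT 2^-1 (integrableD measurableT ixp ip)).
- by [].
- apply/measurable_EFinP; apply: measurable_funM.
    apply: measurableT_comp; first exact: measurable_sqrt.
    exact: measurable_ratio_real.
  exact: measurable_fine_density hf0.
- move=> y _; rewrite /= lee_fin.
  rewrite ger0_norm; last by rewrite mulr_ge0 ?sqrtr_ge0 ?density_real_ge0.
  by apply: le_trans (ler_norm _); exact: sqrt_ratio_le.
Qed.

Local Notation h := (\int[mu]_y (Num.sqrt (x f y) * p y))%R.

Lemma KLstar_ge :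
  (2 * (1 - h))%:E <= KLstar mu f0 fs f.
Proof.
rewrite /KLstar leeBrDr//; apply: le_trans (KL_ge hf).
have is_ := integrable_sqrt_ratio; have ip := integrable_density_real.
have i2 := integrable_lincomb (-2) 2 is_ ip.
(* Regrouped as nested linear combinations; the integral is then [KL fs - 2 h + 2], as [p] has
   integral 1. *)
rewrite (eq_integral (fun y => (1 * L y
  + 1 * (-2 * (Num.sqrt (x f y) * p y) + 2 * p y))%:E)); last first.
  by move=> y _; congr EFin; ring.
rewrite (integral_lincomb _ _ integrable_log_real i2) KL_realE.
rewrite -(EFin_Rintegral integrable_log_real).
rewrite -EFinD lee_fin [X in (1 * _ + 1 * X)%R]/Rintegral.
rewrite integral_lincomb//= /Rintegral integral_density_real/=; lra.
Qed.

Hypothesis ratio_le1 : \int[mu]_y (x f y * p y)%:E <= 1.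

Let Rintegral_ratio_le1 : (\int[mu]_y (x f y * p y) <= 1)%R.
Proof.
by rewrite -lee_fin EFin_Rintegral//; exact: integrable_ratio_real.
Qed.

Let Rintegral_density : (\int[mu]_y p y = 1)%R.
Proof. by rewrite /Rintegral integral_density_real. Qed.

Lemma sqrt_ratio_le1 : (h <= 1)%R.
Proof.
have ixp := integrable_ratio_real; have ip := integrable_density_real.
have is_ := integrable_sqrt_ratio.
have : (h <= \int[mu]_y (2^-1 * (x f y * p y) + 2^-1 * p y))%R.
  apply: le_Rintegral => //; first exact: integrable_lincomb.
  by move=> y _; rewrite -mulrDr; exact: sqrt_ratio_le.
rewrite [leRHS]/Rintegral integral_lincomb//= Rintegral_density.
by move/le_trans; apply; have := Rintegral_ratio_le1; lra.
Qed.

(** Integrating [normB1_le] under [f0] gives [c (E0 x + 1) - (k - 1/k) h] with [2 c = k + 1/k]; then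
    [E0 x <= 1] bounds this by [2 c - (k - 1/k) h], which is the right-hand side. *)
Lemma integral_normB_le k : (0 < k)%R ->
  \int[mu]_y (`|x f y - 1| * p y)%:E <= (k * (1 - h) + k^-1 * (1 + h))%:E.
Proof.
move=> k0; have ixp := integrable_ratio_real; have ip := integrable_density_real.
have is_ := integrable_sqrt_ratio.
pose c := (k / 2 + (2 * k)^-1)%R.
have c0 : (0 <= c)%R by rewrite addr_ge0 ?divr_ge0 ?invr_ge0 ?mulr_ge0// ltW.
have i1 := integrable_lincomb c c ixp ip.
have -> : (k * (1 - h) + k^-1 * (1 + h) = 1 * (c * 1 + c * 1) + (- (k - k^-1)) * h)%R.
  by rewrite /c; field; rewrite gt_eqF.
apply: (@le_trans _ _ (1 * (c * (\int[mu]_y (x f y * p y)) + c * (\int[mu]_y p y))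
    + (- (k - k^-1)) * h)%R%:E); last first.
  by rewrite Rintegral_density lee_fin lerD2r !mul1r lerD2r ler_wpM2l.
have -> : (c * (\int[mu]_y (x f y * p y)) + c * (\int[mu]_y p y))%R =
    fine (\int[mu]_y (c * (x f y * p y) + c * p y)%:E).
  by rewrite integral_lincomb.
rewrite -(integral_lincomb _ _ i1 is_).
apply: ae_le_integral.
- exact: measurable_normB_ratio_real.
- exact: measurable_int (integrable_lincomb _ _ i1 is_).
- apply: aeW => y; rewrite lee_fin.
have := normB1_le k0 (ratio_real_ge0 y hf).
move/(ler_wpM2r (density_real_ge0 y))/le_trans; apply.
rewrite le_eqVlt; apply/orP; left; apply/eqP => /=; rewrite -/c. ring.
Qed.
End finite_expectation.
End real_valued_representatives.

(** * Pairing integrable functions with essentially bounded ones *)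

Section essentially_bounded.
Context d (Y : measurableType d) (R : realType).
Variable nu : {measure set Y -> \bar R}.

Lemma Lfun_pinfty_bounded (phi : Y -> R) : phi \in Lfun nu +oo ->
  exists2 M : R, (0 < M)%R & {ae nu, forall y, (`|phi y| <= M)%R}.
Proof.
move=> /sub_Lfun_finLfun; rewrite inE /= /finite_norm unlock.
case: ifPn => [_ /ess_supr_bounded[M phiM]|]; last first.
  (* If [nu] is the zero measure, the whole space is null and any bound holds a.e. *)
  rewrite -leNgt => nu0 _; exists 1%R => //; exists setT; split=> //.
  by apply/eqP; rewrite -measure_le0.
(* The maximum with 1 makes the bound positive, so that it can be divided by. *)
exists (Num.max M 1)%R; first by rewrite lt_max ltr01 orbT.
by apply: filterS phiM => y; rewrite le_max => ->.
Qed.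

Lemma integrable_ae_boundedM (phi : Y -> R) (M : R) (f : Y -> \bar R) :
  measurable_fun setT phi -> (0 < M)%R -> {ae nu, forall y, (`|phi y| <= M)%R} ->
  nu.-integrable setT f -> nu.-integrable setT (fun y => (phi y)%:E * f y).
Proof.
move=> mphi M0 phiM /integrableP[mf f_lty].
have mphif : measurable_fun setT (fun y => (phi y)%:E * f y).
  by apply: emeasurable_funM => //; exact/measurable_EFinP.
apply/integrableP; split => //.
apply: (@le_lt_trans _ _ (\int[nu]_y (M%:E * `|f y|))).
  apply: ae_le_integral; first exact: measurableT_comp.
    by apply: measurable_funeM; exact: measurableT_comp.
  apply: filterS phiM => y phiM; rewrite abseM lee_wpmul2r//.
by rewrite ge0_integralZl ?lte_mul_pinfty ?lee_fin ?ltW//; exact: measurableT_comp.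
Qed.

Lemma integral_ae_boundedM_le (phi : Y -> R) (M : R) (f g : Y -> \bar R) :
  measurable_fun setT phi -> (0 < M)%R -> {ae nu, forall y, (`|phi y| <= M)%R} ->
  nu.-integrable setT f -> nu.-integrable setT g ->
  `|\int[nu]_y ((phi y)%:E * f y) - \int[nu]_y ((phi y)%:E * g y)| <=
  M%:E * \int[nu]_y `|f y - g y|.
Proof.
move=> mphi M0 phiM i_f ig.
have iphif := integrable_ae_boundedM mphi M0 phiM i_f.
have iphig := integrable_ae_boundedM mphi M0 phiM ig.
have mfg : measurable_fun setT (fun y => f y - g y).
  exact: measurable_int (integrableB measurableT i_f ig).
rewrite -integralB//; apply: le_trans (le_abse_integral _ _ _) _ => //.
  exact: measurable_int (integrableB measurableT iphif iphig).
rewrite -ge0_integralZl ?lee_fin ?(ltW M0)//; last exact: measurableT_comp.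
apply: ae_le_integral.
- apply: measurableT_comp => //.
  exact: measurable_int (integrableB measurableT iphif iphig).
- by apply: measurable_funeM; exact: measurableT_comp.
(* Both functions are finite a.e., so [phi] distributes over their difference in [\bar R]. *)
have := integrable_ae measurableT i_f; have := integrable_ae measurableT ig.
apply: filterS3 phiM => y phiM /(_ I) gy /(_ I) fy.
by rewrite -muleBr// ?abseM ?lee_wpmul2r// fin_num_adde_defl// fin_numN.
Qed.

End essentially_bounded.

(** * Consequences of minimality on a convex family: the [L1(mu0)] estimate and neighborhoods of
    [fs] *)

Section projection.
Context d (Y : measurableType d) (R : realType).
Variables (mu : {sigma_finite_measure set Y -> \bar R}).
Variable (S : set (set (Y -> \bar R))).
Variables (F0 : set (Y -> \bar R)) (f0 fs : Y -> \bar R).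
Hypotheses (F0_family : measurable_family mu S F0).
Hypotheses (f0_density : density mu f0) (fs_density : density mu fs).
Hypothesis fs_min : minimizes_KL mu f0 F0 fs.
Hypothesis ratio_finite : forall f, F0 f ->
  expectation_under mu f0 (fun y => f y / fs y) < +oo.
Hypothesis mu0_finite : \int[mu]_y (f0 y / fs y) < +oo.
Hypothesis F0_convex : mixture_convex mu S F0.

Let mu0 : {measure set Y -> \bar R} := ratio_measure f0_density fs_density.

Lemma mixture_hull_id : mixture_hull mu S F0 = F0.
Proof.
apply/seteqP; split=> f; first by apply.
by move=> Ff A _; apply.
Qed.

Lemma expectation_ratio_le1 f : F0 f ->
  expectation_under mu f0 (fun y => f y / fs y) <= 1.
Proof.
move=> Ff; have [Ffs KLinf KLfin] := fs_min; have [FD _ _] := F0_family.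
rewrite (expectation_ratioE f0_density fs_density KLfin (FD _ Ff)).
apply: integral_ratio_le1 => //; [exact: FD|exact: ratio_finite|].
move=> t t01 ft; have Fft : F0 ft.
  by apply: (mixture_convex2 F0_family F0_convex Ff Ffs); move: t01 {ft}; lra.
split; first exact: FD.
by rewrite KLinf; apply: ereal_inf_lbound; exists ft.
Qed.

(** After the change of measure, the integral of [f] against [mu0] is [E0 (f / fs)], which
    [ratio_finite] makes finite. *)
Lemma integrable_ratio_measure f : F0 f -> mu0.-integrable setT f.
Proof.
move=> Ff; have [FD _ _] := F0_family; have [mf f_ge0 _] := FD _ Ff.
apply/integrableP; split=> //.
under eq_integral do rewrite gee0_abs//.
rewrite ge0_integral_ratio_measure//.
by under eq_integral do rewrite muleCA muleC; exact: ratio_finite.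
Qed.

(** Translates the real estimates back to [hstar], [KLstar] and [mu0]; [k] stays free, to be matched
    to the radius of a neighborhood. *)
Lemma L1_dist_le f (k : R) : F0 f -> (0 < k)%R -> exists h : R,
  [/\ hstar mu f0 fs 2^-1 f = h%:E,
      (2 * (1 - h))%:E <= KLstar mu f0 fs f, (h <= 1)%R &
      \int[mu0]_y `|f y - fs y| <= (k * (1 - h) + k^-1 * (1 + h))%:E].
Proof.
move=> Ff k0; have [Ffs KLinf KLfin] := fs_min; have [FD _ _] := F0_family.
have hf := FD _ Ff; have Elty := ratio_finite Ff.
have Ele1 := expectation_ratio_le1 Ff.
rewrite (expectation_ratioE f0_density fs_density KLfin hf) in Ele1.
eexists; split.
- rewrite /hstar invr_eq0 pnatr_eq0/=.
  rewrite (expectation_sqrt_ratioE f0_density fs_density KLfin hf).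
  by rewrite -EFin_Rintegral//; exact: integrable_sqrt_ratio.
- exact: KLstar_ge.
- exact: sqrt_ratio_le1.
- rewrite ge0_integral_ratio_measure//.
    rewrite (normB_ratioE f0_density fs_density KLfin hf).
    exact: integral_normB_le.
  apply: measurableT_comp => //; apply: emeasurable_funB; first by case: hf.
  by case: fs_density.
Qed.

(** Either premise gives [1 - h < e^2 / 16], the first through [2 (1 - h) <= KLstar]. With
    [k = 4 / e], the term [k (1 - h)] is below [e / 4] and [(1 + h) / k] is at most [e / 2], so the
    sum stays below [3 e / 4]. *)
Lemma L1_dist_lt f (e : R) : F0 f -> (0 < e)%R ->
  KLstar mu f0 fs f < (e ^+ 2 / 8)%:E \/
  (1 - e ^+ 2 / 16)%:E < hstar mu f0 fs 2^-1 f ->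
  \int[mu0]_y `|f y - fs y| < e%:E.
Proof.
move=> Ff e0; have k0 : (0 < 4 / e)%R by rewrite divr_gt0.
have [h [-> KLh h1 L1h]] := L1_dist_le Ff k0 => near_fs.
apply: (le_lt_trans L1h); rewrite lte_fin.
have {KLh near_fs} : (1 - h < e ^+ 2 / 16)%R.
  case: near_fs => [/(le_lt_trans KLh)|]; rewrite lte_fin; lra.
rewrite -(ltr_pM2l k0) => lt_h.
apply: (lt_le_trans (y := (4 / e * (e ^+ 2 / 16) + (4 / e)^-1 * 2)%R)).
  by rewrite ltr_leD// ler_wpM2l ?invr_ge0 ?(ltW k0)//; lra.
rewrite (_ : _ + _ = 3 / 4 * e)%R; first lra.
by field; rewrite gt_eqF.
Qed.

Lemma neighborhood_L1 (basic : set (set (Y -> \bar R))) U :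
  basic = L1_basic mu0 fs \/ basic = weak_basic mu0 fs ->
  neighborhood_in basic F0 U ->
  exists2 e : R, (0 < e)%R &
    forall f, F0 f -> \int[mu0]_y `|f y - fs y| < e%:E -> U f.
Proof.
move=> [->|->] [_ [V]].
  by move=> [e e0 ->] VU; exists e => // f Ff fe; exact: VU.
move=> [n [phi [r [phi_Lfun r0 ->]]]] VU.
have [Ffs _ _] := fs_min.
pose M i := s2val (cid2 (Lfun_pinfty_bounded (phi_Lfun i))).
have M0 i : (0 < M i)%R by rewrite /M; case: cid2.
have phiM i : {ae mu0, forall y, (`|phi i y| <= M i)%R} by rewrite /M; case: cid2.
(* Within this radius each test integral moves by less than [M i * (r i / M i) = r i]; the default 1
   keeps the radius positive when [n = 0]. *)
exists (\big[Num.min/1%R]_(i < n) (r i / M i)%R).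
  by apply: lt_bigmin => // i _; rewrite divr_gt0.
move=> f Ff fe; apply: VU; split=> // i.
have mphi : measurable_fun setT (phi i).
  by have := sub_Lfun_mfun (phi_Lfun i); rewrite inE.
apply: (le_lt_trans (integral_ae_boundedM_le mphi (M0 i) (phiM i)
  (integrable_ratio_measure Ff) (integrable_ratio_measure Ffs))).
rewrite -lte_pdivlMl//; apply: (lt_le_trans fe).
by rewrite lee_fin mulrC; exact: bigmin_le_cond.
Qed.

End projection.

Theorem theorem6 (d : measure_display) (Y : measurableType d) (R : realType)
    (mu : {sigma_finite_measure set Y -> \bar R})
    (S : set (set (Y -> \bar R)))
    (F0 : set (Y -> \bar R)) (f0 fs : Y -> \bar R)
    (F0_family : measurable_family mu S F0)
    (f0_density : density mu f0) (fs_density : density mu fs)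
    (fs_min : minimizes_KL mu f0 F0 fs)
    (fs_unique : forall f, F0 f -> KL mu f0 f = KL mu f0 fs ->
       {ae mu, forall y, f y = fs y})
    (ratio_finite : forall f, F0 f ->
       expectation_under mu f0 (fun y => f y / fs y) < +oo)
    (mu0_finite : \int[mu]_y (f0 y / fs y) < +oo)
    (F0_convex : mixture_convex mu S F0) :
  let mu0 : {measure set Y -> \bar R} := ratio_measure f0_density fs_density in
  let hull := mixture_hull mu S F0 in
  hull = F0 /\
  forall basic : set (set (Y -> \bar R)),
    basic = L1_basic mu0 fs \/ basic = weak_basic mu0 fs ->
  [/\ forall U, neighborhood_in basic hull U ->
        exists2 delta : R, (0 < delta)%R &
          [set f | hull f /\ KLstar mu f0 fs f < delta%:E] `<=` U,
      forall U, neighborhood_in basic hull U ->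
        exists2 delta : R, (0 < delta)%R &
          [set f | hull f /\
             (expR (- delta))%:E <
               ereal_inf [set hstar mu f0 fs alpha f | alpha in `[0%R, 1%R]]]
            `<=` U
    & forall U, neighborhood_in basic F0 U ->
        exists (alpha0 : R) (delta : R),
          [/\ (0 < alpha0 < 1)%R, (0 < delta)%R &
            [set f | F0 f /\ (expR (- delta))%:E < hstar mu f0 fs alpha0 f]
              `<=` U]].
Proof.
move=> mu0 hull; have hullE : hull = F0 by exact: mixture_hull_id.
split=> // basic hbasic; rewrite hullE.
have L1_lt := @L1_dist_lt _ _ _ _ _ _ _ _ F0_family f0_density fs_density
  fs_min ratio_finite mu0_finite F0_convex.
have nbhsP U := @neighborhood_L1 _ _ _ _ _ _ _ _ F0_family f0_density fs_density
  fs_min ratio_finite mu0_finite basic U hbasic.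
have hstar_near f (e : R) : F0 f -> (0 < e)%R ->
    (expR (- (e ^+ 2 / 16)))%:E < hstar mu f0 fs 2^-1 f ->
    \int[mu0]_y `|f y - fs y| < e%:E.
  move=> Ff e0 hf; apply: L1_lt => //; right; apply: le_lt_trans hf.
  (* The inequality [1 - u <= exp (- u)] with [u = e^2 / 16] lets the exponential threshold imply
     the linear one. *)
  by rewrite lee_fin expR_ge1Dx.
split=> U /nbhsP[e e0 eU].
- exists (e ^+ 2 / 8)%R; first by rewrite divr_gt0// exprn_gt0.
  by move=> f [Ff KLf]; apply: eU => //; apply: L1_lt => //; left.
- exists (e ^+ 2 / 16)%R; first by rewrite divr_gt0// exprn_gt0.
  move=> f [Ff hf]; apply: eU => //; apply: hstar_near => //.
  (* The infimum over [alpha] is at most the value at [1/2]. *)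
  apply: (lt_le_trans hf); apply: ereal_inf_lbound.
  by exists 2^-1%R => //=; rewrite in_itv/= invr_ge0 ler0n invf_le1// ler1n.
- exists 2^-1%R, (e ^+ 2 / 16)%R; split.
  + by rewrite invr_gt0 ltr0n invf_lt1// ltr1n.
  + by rewrite divr_gt0// exprn_gt0.
  + by move=> f [Ff hf]; apply: eU => //; exact: hstar_near.
Qed.
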